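(* Let $n,\gamma\in\mathbb{N}$, $d\in\{0,\ldots,n\}$, nodes $a=x_0<x_1<\dots<x_n=b$ and $f:[a,b]\to\mathbb{R}$. For $k=0,\ldots,n$ put $$J_k=\{i\in\{0,1,\ldots,n-d\}:\ k-d\le i\le k\},\qquad w_k(x)=\sum_{i\in J_k}(-1)^{i\gamma}\prod_{s=i,\,s\ne k}^{i+d}\frac{1}{(x_k-x_s)(x-x_s)^{\gamma-1}}.$$ Then the generalized Floater--Hormann interpolant of $f$ has the barycentric-type representation $$\tilde r(x)=\frac{\displaystyle\sum_{k=0}^n\frac{w_k(x)}{(x-x_k)^\gamma}\,f(x_k)}{\displaystyle\sum_{k=0}^n\frac{w_k(x)}{(x-x_k)^\gamma}},\qquad x\in\mathbb{R}\setminus\{x_0,\ldots,x_n\}.$$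
   Context: $\mathbb{N}=\{1,2,3,\ldots\}$. Given nodes $a=x_0<x_1<\dots<x_n=b$, a function $f:[a,b]\to\mathbb{R}$, an integer $0\le d\le n$ and $\gamma\in\mathbb{N}$, for $i=0,\ldots,n-d$ let $p_i$ be the unique polynomial of degree $\le d$ interpolating $f$ at $x_i,x_{i+1},\ldots,x_{i+d}$, and let $$\tilde\lambda_i(x)=\frac{(-1)^{i\gamma}}{(x-x_i)^\gamma(x-x_{i+1})^\gamma\cdots(x-x_{i+d})^\gamma}.$$ The generalized Floater--Hormann interpolant of $f$ is $$\tilde r(x)=\frac{\sum_{i=0}^{n-d}\tilde\lambda_i(x)p_i(x)}{\sum_{i=0}^{n-d}\tilde\lambda_i(x)}.$$ Empty products equal $1$. *)

(* Defs.v *)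
From HB Require Import structures.
From mathcomp Require Import all_boot all_order all_algebra.
From mathcomp Require Import all_classical all_reals.

Set Implicit Arguments.
Unset Strict Implicit.
Unset Printing Implicit Defensive.

Import Order.TTheory GRing.Theory Num.Theory.

Local Open Scope ring_scope.

(* Indices of the nodes x_i, ..., x_(i+d). *)
Definition block (n d i : nat) : {set 'I_n.+1} :=
  [set s : 'I_n.+1 | (i <= s <= i + d)%N].

Definition interpolates (R : realType) (n d : nat) (x : 'I_n.+1 -> R)
    (f : R -> R) (i : nat) (p : {poly R}) : Prop :=
  (size p <= d.+1)%N /\ forall s : 'I_n.+1, s \in block n d i -> p.[x s] = f (x s).

(* The polynomial selected by this description exists and is unique whenever
   the nodes are distinct and i + d <= n, see interp_poly_unique below; the
   default value 0 of xget is then irrelevant. *)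
Definition interp_poly (R : realType) (n d : nat) (x : 'I_n.+1 -> R)
    (f : R -> R) (i : nat) : {poly R} :=
  xget 0 [set p : {poly R} | interpolates d x f i p]%classic.

Definition fh_lambda (R : realType) (n d gamma : nat) (x : 'I_n.+1 -> R)
    (i : nat) (t : R) : R :=
  (-1) ^+ (i * gamma) / \prod_(s in block n d i) (t - x s) ^+ gamma.

Definition fh_interpolant (R : realType) (n d gamma : nat) (x : 'I_n.+1 -> R)
    (f : R -> R) (t : R) : R :=
  (\sum_(i < (n - d).+1) fh_lambda d gamma x i t * (interp_poly d x f i).[t]) /
  (\sum_(i < (n - d).+1) fh_lambda d gamma x i t).

(* The truncated subtraction k - d is harmless, since 0 <= i. *)
Definition fh_J (n d k : nat) : {set 'I_(n - d).+1} :=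
  [set i : 'I_(n - d).+1 | (k - d <= i <= k)%N].

Definition fh_w (R : realType) (n d gamma : nat) (x : 'I_n.+1 -> R)
    (k : 'I_n.+1) (t : R) : R :=
  \sum_(i in fh_J n d k)
    (-1) ^+ (i * gamma) *
    \prod_(s in block n d i | s != k)
      (1 / ((x k - x s) * (t - x s) ^+ (gamma - 1))).

Lemma card_block (n d i : nat) : (i + d <= n)%N -> #|block n d i| = d.+1.
Proof.
move=> hid.
have hlt (j : 'I_d.+1) : (i + j < n.+1)%N.
  by rewrite ltnS (leq_trans _ hid)// leq_add2l -ltnS.
pose g (j : 'I_d.+1) : 'I_n.+1 := Ordinal (hlt j).
have g_inj : injective g by move=> j k /(congr1 val)/= /addnI/val_inj.
rewrite -[RHS]card_ord -(card_imset _ g_inj); apply: eq_card => s.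
rewrite inE; apply/idP/imsetP => [/andP[his hsd]|[j _ ->]] /=.
  have hj : (s - i < d.+1)%N by rewrite ltnS leq_subLR.
  by exists (Ordinal hj) => //; apply/val_inj; rewrite /= subnKC.
by rewrite leq_addr leq_add2l -ltnS ltn_ord.
Qed.

Lemma interp_poly_unique (R : realType) (n d : nat) (x : 'I_n.+1 -> R)
    (f : R -> R) (i : nat) (x_inj : injective x) (hid : (i + d <= n)%N)
    (p : {poly R}) :
  interpolates d x f i p <-> p = interp_poly d x f i.
Proof.
pose B := block n d i.
have cB : #|B| = d.+1 by exact: card_block.
have uniqP (q1 q2 : {poly R}) :
    interpolates d x f i q1 -> interpolates d x f i q2 -> q1 = q2.
  move=> [s1 h1] [s2 h2]; apply/eqP; rewrite -subr_eq0; apply/eqP.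
  apply: (@roots_geq_poly_eq0 _ _ [seq x s | s <- enum B]).
  - apply/allP => _ /mapP[s + ->]; rewrite mem_enum => sB.
    by rewrite rootE hornerD hornerN h1// h2// subrr.
  - by rewrite map_inj_uniq// enum_uniq.
  - rewrite size_map -cardE cB (leq_trans (size_polyD _ _))//.
    by rewrite size_polyN geq_max s1.
pose L (k : 'I_n.+1) : {poly R} :=
  \prod_(s in B :\ k) ((x k - x s)^-1 *: ('X - (x s)%:P)).
have sizeL k : k \in B -> (size (L k) <= d.+1)%N.
  move=> kB; rewrite /L.
  rewrite scaler_prod (leq_trans (size_scale_leq _ _))//.
  rewrite (eq_bigl [in enum (B :\ k)]) => [|s]; last by rewrite /= mem_enum.
  rewrite -big_uniq ?enum_uniq// size_prod_XsubC -cardE.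
  by rewrite -cB (cardsD1 k B) kB.
have ex : exists q, interpolates d x f i q.
  exists (\sum_(k in B) f (x k) *: L k); split.
    rewrite (leq_trans (size_sum _ _ _))//; apply/bigmax_leqP => k kB.
    by rewrite (leq_trans (size_scale_leq _ _))// sizeL.
  move=> k kB; rewrite horner_sum (bigD1 k)//= hornerZ horner_prod.
  rewrite big1 ?mulr1 => [|s]; last first.
    rewrite !inE => /andP[sk _].
    rewrite hornerZ hornerXsubC mulVf// subr_eq0.
    by rewrite (inj_eq x_inj) eq_sym.
  rewrite big1 ?addr0// => j /andP[jB jk].
  rewrite hornerZ horner_prod (bigD1 k)/=; last by rewrite in_setD1 eq_sym jk.
  by rewrite hornerZ hornerXsubC subrr mulr0 mul0r mulr0.
have spec : interpolates d x f i (interp_poly d x f i).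
  exact: (@xgetPex _ 0 [set q : {poly R} | interpolates d x f i q]%classic ex).
by split=> [hp|->//]; exact: uniqP.
Qed.

(* Main.v *)
Require Import Defs.
From mathcomp Require Import all_boot all_order all_algebra.
From mathcomp Require Import all_classical all_reals.
From mathcomp Require Import ring.

Import Order.TTheory GRing.Theory Num.Theory.

Local Open Scope ring_scope.

(** Expand each local interpolant in Lagrange form on its block of nodes.  In
    lambda_i times the k-th Lagrange basis polynomial, every node s <> k of the
    block contributes (t - x_s) / (x_k - x_s) / (t - x_s)^gamma, that is, one
    factor of w_k, while the node k contributes 1 / (t - x_k)^gamma.  Exchanging
    the sums over i and k gives the numerator, and the denominator is the case
    of the constant function 1, whose local interpolants are all 1. *)

Lemma lagrange_expansion (F : fieldType) (I : finType) (x : I -> F)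
    (x_inj : injective x) (B : {set I}) (p : {poly F}) :
  (size p <= #|B|)%N ->
  p = \sum_(k in B)
        p.[x k] *: \prod_(s in B | s != k) ((x k - x s)^-1 *: ('X - (x s)%:P)).
Proof.
move=> size_p.
set L := fun k => \prod_(s in B | s != k) ((x k - x s)^-1 *: ('X - (x s)%:P)).
have size_L k : k \in B -> (size (L k) <= #|B|)%N.
  move=> kB; rewrite /L scaler_prod (leq_trans (size_scale_leq _ _))//.
  rewrite (eq_bigl [in enum (B :\ k)]) => [|s]; last first.
    by rewrite /= mem_enum !inE andbC.
  by rewrite -big_uniq ?enum_uniq// size_prod_XsubC -cardE (cardsD1 k B) kB.
(* The difference of the two sides has size at most [#|B|] but vanishes at the [#|B|] distinct nodes
   of [B], so it is zero. *)
apply/eqP; rewrite -subr_eq0; apply/eqP.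
apply: (@roots_geq_poly_eq0 _ _ [seq x s | s <- enum B]).
- apply/allP => _ /mapP[k + ->]; rewrite mem_enum => kB.
  rewrite rootE hornerD hornerN horner_sum (bigD1 k)//= hornerZ horner_prod.
  rewrite big1 ?mulr1 => [|s /andP[_ sk]]; last first.
    by rewrite hornerZ hornerXsubC mulVf// subr_eq0 (inj_eq x_inj) eq_sym.
  rewrite big1 ?addr0 ?subrr// => j /andP[jB jk].
  rewrite hornerZ horner_prod (bigD1 k)/=; last by rewrite kB eq_sym.
  by rewrite hornerZ hornerXsubC subrr mulr0 mul0r mulr0.
- by rewrite map_inj_uniq// enum_uniq.
- rewrite size_map -cardE (leq_trans (size_polyD _ _))// size_polyN geq_max.
  rewrite size_p (leq_trans (size_sum _ _ _))//; apply/bigmax_leqP => k kB.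
  by rewrite (leq_trans (size_scale_leq _ _))// size_L.
Qed.

Lemma fh_lambda_mul_interpolant (R : realType) (n d gamma i : nat)
    (x : 'I_n.+1 -> R) (f : R -> R) (p : {poly R}) (t : R) :
  injective x -> (0 < gamma)%N -> (i + d <= n)%N ->
  (forall k, t != x k) -> interpolates d x f i p ->
  fh_lambda d gamma x i t * p.[t] =
  \sum_(k in block n d i)
    (-1) ^+ (i * gamma) *
    \prod_(s in block n d i | s != k)
      (1 / ((x k - x s) * (t - x s) ^+ (gamma - 1)))
    / (t - x k) ^+ gamma * f (x k).
Proof.
move=> x_inj gamma_gt0 hid ht [size_p pE].
rewrite {1}(@lagrange_expansion _ _ x x_inj (block n d i) p) ?card_block//.
rewrite horner_sum mulr_sumr; apply: eq_bigr => k kB.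
rewrite pE// hornerZ horner_prod /fh_lambda (bigD1 k)//= invfM.
set P := \prod_(s in _ | _) _ ^+ _; set Q := \prod_(s in _ | _) _.[t].
set W := \prod_(s in _ | _) (1 / _).
(* Both sides share the sign, the inverse of [(t - x k) ^+ gamma] and [f (x k)]; only products over
   [s != k] remain, to be compared factor by factor. *)
suff -> : W = Q / P by ring.
rewrite /W /P /Q -prodfV -big_split/=; apply: eq_bigr => s _.
have tx : t - x s != 0 by rewrite subr_eq0.
rewrite hornerZ hornerXsubC div1r invfM -mulrA; congr (_ * _).
(* As [gamma] is positive, one factor [t - x s] splits off the power and cancels the numerator of
   the Lagrange factor. *)
by rewrite -[X in _ = _ * (_ ^+ X)^-1](subnKC gamma_gt0) exprS invfM mulVKf.
Qed.

(** The bound [k - d <= i] means [k <= d + i] even for truncated subtraction; this identifies the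
    inner index set once the sums are exchanged. *)
Lemma mem_fh_J (n d : nat) (i : 'I_(n - d).+1) (k : 'I_n.+1) :
  (i \in fh_J n d k) = (k \in block n d i).
Proof. by rewrite !inE leq_subLR [(d + i)%N]addnC andbC. Qed.

(** The family [p] is left arbitrary so that the same identity serves the numerator, with
    [interp_poly], and the denominator, with the constant 1. *)
Lemma sum_fh_lambda_mul_interpolant (R : realType) (n d gamma : nat)
    (x : 'I_n.+1 -> R) (f : R -> R) (p : nat -> {poly R}) (t : R) :
  injective x -> (0 < gamma)%N -> (d <= n)%N -> (forall k, t != x k) ->
  (forall i, (i + d <= n)%N -> interpolates d x f i (p i)) ->
  \sum_(i < (n - d).+1) fh_lambda d gamma x i t * (p i).[t] =
  \sum_(k < n.+1) fh_w d gamma x k t / (t - x k) ^+ gamma * f (x k).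
Proof.
move=> x_inj gamma_gt0 hd ht pE.
have hid (i : 'I_(n - d).+1) : (i + d <= n)%N.
  by rewrite addnC -leq_subRL// -ltnS.
rewrite (eq_bigr _ (fun i _ => fh_lambda_mul_interpolant _ _ _ _ _ _ f _ t
  x_inj gamma_gt0 (hid i) ht (pE _ (hid i)))).
(* The block depends on [i], so [k] now runs over all nodes and the membership condition moves to
   the inner sum. *)
rewrite (exchange_big_dep xpredT)//=; apply: eq_bigr => k _.
rewrite /fh_w !mulr_suml; apply: eq_bigl => i.
by rewrite mem_fh_J.
Qed.

Theorem mainTheorem4 (R : realType) (n gamma d : nat)
    (hn : (1 <= n)%N) (hgamma : (1 <= gamma)%N) (hd : (d <= n)%N)
    (a b : R) (x : 'I_n.+1 -> R)
    (hxa : x ord0 = a) (hxb : x ord_max = b)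
    (hx : forall i j : 'I_n.+1, (i < j)%N -> x i < x j)
    (f : R -> R) (t : R) (ht : forall k : 'I_n.+1, t != x k) :
  fh_interpolant d gamma x f t =
  (\sum_(k < n.+1) fh_w d gamma x k t / (t - x k) ^+ gamma * f (x k)) /
  (\sum_(k < n.+1) fh_w d gamma x k t / (t - x k) ^+ gamma).
Proof.
have x_inj : injective x.
  move=> i j xij; have [/hx|/hx|/val_inj//] := ltngtP i j.
    by rewrite xij ltxx.
  by rewrite xij ltxx.
rewrite /fh_interpolant; congr (_ / _).
  apply: sum_fh_lambda_mul_interpolant => // i hid.
  (* Read from right to left at [interp_poly] itself, the equivalence says that the chosen
     polynomial does interpolate. *)
  exact/(interp_poly_unique f x_inj hid).
transitivity (\sum_(i < (n - d).+1) fh_lambda d gamma x i t * (1 : {poly R}).[t]).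
  by apply: eq_bigr => i _; rewrite hornerC mulr1.
rewrite (sum_fh_lambda_mul_interpolant _ _ _ _ _ (fun=> 1) (fun=> 1) _
  x_inj hgamma hd ht) => [|i _].
  by apply: eq_bigr => k _; rewrite mulr1.
by split=> [|s _]; rewrite ?size_poly1 ?hornerC.
Qed.
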